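(* Let $\mathbb K$ be an algebraically closed field of characteristic zero, and let $V$ and $W$ be indecomposable $\mathbb K[x,y]$-modules, finite dimensional over $\mathbb K$, with $\dim_{\mathbb K}V=\dim_{\mathbb K}W\ge 7$. Let $L_V=\mathbb K\langle P,Q\rangle\rightthreetimes V$ and $L_W=\mathbb K\langle S,T\rangle\rightthreetimes W$ be their associated Lie algebras. Then the $\mathbb K[x,y]$-modules $V$ and $W$ are weakly isomorphic if and only if the Lie algebras $L_V$ and $L_W$ are isomorphic.
   Context: Associated Lie algebra: for a $\mathbb K[x,y]$-module $V$, let $P,Q$ be the commuting linear operators $P(v)=x\cdot v$, $Q(v)=y\cdot v$ on $V$. The Lie algebra $L_V=\mathbb K\langle P,Q\rangle\rightthreetimes V$ associated with $V$ is the external semidirect product of the two-dimensional abelian Lie algebra with basis $P,Q$ (always two-dimensional, even if $P,Q$ are linearly dependent as operators) and the abelian Lie algebra $V$: as a vector space it is $\mathbb K\langle P,Q\rangle\oplus V$, with bracket $[P,Q]=0$, $[v,v']=0$, $[P,v]=P(v)$, $[Q,v]=Q(v)$ for $v,v'\in V$. Likewise $L_W=\mathbb K\langle S,T\rangle\rightthreetimes W$, with $S,T$ given by the actions of $x,y$ on $W$. Weak isomorphism: a linear automorphism $\theta$ of $\mathbb K[x,y]$ is a $\mathbb K$-algebra automorphism of the form $\theta(x)=\alpha_{11}x+\alpha_{12}y$, $\theta(y)=\alpha_{21}x+\alpha_{22}y$ with $[\alpha_{ij}]$ a nonsingular matrix over $\mathbb K$. The twisted module $V_\theta$ is the vector space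 $V$ with the action $x\circ v=\theta(x)\cdot v$, $y\circ v=\theta(y)\cdot v$. Modules $V$ and $W$ are weakly isomorphic if there is a finite sequence of $\mathbb K[x,y]$-modules $V_1=V,V_2,\dots,V_k=W$ such that for each $i=1,\dots,k-1$ either $V_i\simeq V_{i+1}$ or $V_{i+1}=(V_i)_{\theta_i}$ for some linear automorphism $\theta_i$. *)

(* Defs.v *)
From HB Require Import structures.
From mathcomp Require Import all_boot all_order all_algebra.
From mathcomp Require Export mpoly.

Set Implicit Arguments.
Unset Strict Implicit.
Unset Printing Implicit Defensive.

Import GRing.Theory.
Local Open Scope ring_scope.

HB.mixin Record Lmodule_isLie (K : fieldType) (L : Type)
    of GRing.Lmodule K L := {
  lieb : L -> L -> L;
  lieb_linearl : forall w, linear (lieb^~ w);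
  lieb_linearr : forall u, linear (lieb u);
  liebxx : forall u, lieb u u = 0;
  lieb_jacobi : forall u v w,
    lieb u (lieb v w) + lieb v (lieb w u) + lieb w (lieb u v) = 0
}.

#[short(type="lieAlgType")]
HB.structure Definition LieAlgebra (K : fieldType) :=
  {L of Lmodule_isLie K L & GRing.Lmodule K L}.

Definition lie_isomorphic (K : fieldType) (L M : lieAlgType K) : Prop :=
  exists f : {linear L -> M},
    bijective f /\ forall u v, f (lieb u v) = lieb (f u) (f v).

(* The linear form a_0 x + a_1 y in K[x,y], with x = 'X_0 and y = 'X_1. *)
Definition linform (K : fieldType) (a : 'rV[K]_2) : {mpoly K[2]} :=
  \sum_(i < 2) a 0 i *: 'X_i.

Lemma linform_is_linear (K : fieldType) : linear (@linform K).
Proof.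
move=> c a b; rewrite /linform scaler_sumr -big_split /=.
by apply: eq_bigr => i _; rewrite !mxE scalerDl scalerA.
Qed.

HB.instance Definition _ (K : fieldType) :=
  GRing.isLinear.Build K 'rV[K]_2 {mpoly K[2]} *:%R (@linform K)
    (@linform_is_linear K).

Section Modules.
Variable K : fieldType.
Implicit Types V W : lmodType {mpoly K[2]}.

Definition mod_isomorphic V W : Prop :=
  exists f : {linear V -> W}, bijective f.

(* Boolean predicates lose no generality for modules finite dimensional over K:
   membership in the span of finitely many vectors is decidable. *)
Definition indecomposable V : Prop :=
  (exists v : V, v != 0) /\
  forall U1 U2 : {pred V},
    GRing.submod_closed U1 -> GRing.submod_closed U2 ->
    (forall v, exists u1 u2, [/\ u1 \in U1, u2 \in U2 & v = u1 + u2]) ->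
    (forall v, v \in U1 -> v \in U2 -> v = 0) ->
    U1 =i pred1 0 \/ U2 =i pred1 0.

(* V as a K-vector space, by restriction of scalars along K -> K[x,y]. *)
Definition kspace V : Type := V.
HB.instance Definition _ V := GRing.Zmodule.on (kspace V).

Section KSpace.
Variable V : lmodType {mpoly K[2]}.
Definition kscale (c : K) (v : kspace V) : kspace V := c%:MP *: (v : V).

Fact kscalerA a b v : kscale a (kscale b v) = kscale (a * b) v.
Proof. by rewrite /kscale scalerA mpolyCM. Qed.
Fact kscale1r : left_id 1 kscale.
Proof. by move=> v; rewrite /kscale mpolyC1 scale1r. Qed.
Fact kscalerDr : right_distributive kscale +%R.
Proof. by move=> a u v; rewrite /kscale scalerDr. Qed.
Fact kscalerDl v : {morph kscale^~ v : a b / a + b}.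
Proof. by move=> a b; rewrite /kscale mpolyCD scalerDl. Qed.

HB.instance Definition _ := GRing.Zmodule_isLmodule.Build K (kspace V)
  kscalerA kscale1r kscalerDr kscalerDl.
End KSpace.

Definition has_kdim V (n : nat) : Prop := inhabited (Vector.axiom n (kspace V)).

Definition linear_automorphism
    (theta : {lrmorphism {mpoly K[2]} -> {mpoly K[2]}}) : Prop :=
  bijective theta /\
  exists2 A : 'M[K]_2, A \in unitmx & forall i, theta 'X_i = linform (row i A).

(* V_theta: the carrier of V, with p acting as theta p. *)
Definition twist V (theta : {lrmorphism {mpoly K[2]} -> {mpoly K[2]}}) : Type :=
  V.
HB.instance Definition _ V theta := GRing.Zmodule.on (twist V theta).

Section Twist.
Variables (V : lmodType {mpoly K[2]}).
Variable theta : {lrmorphism {mpoly K[2]} -> {mpoly K[2]}}.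
Definition twist_scale (p : {mpoly K[2]}) (v : twist V theta) : twist V theta :=
  theta p *: (v : V).

Fact twist_scalerA a b v :
  twist_scale a (twist_scale b v) = twist_scale (a * b) v.
Proof. by rewrite /twist_scale scalerA rmorphM. Qed.
Fact twist_scale1r : left_id 1 twist_scale.
Proof. by move=> v; rewrite /twist_scale rmorph1 scale1r. Qed.
Fact twist_scalerDr : right_distributive twist_scale +%R.
Proof. by move=> a u v; rewrite /twist_scale scalerDr. Qed.
Fact twist_scalerDl v : {morph twist_scale^~ v : a b / a + b}.
Proof. by move=> a b; rewrite /twist_scale rmorphD scalerDl. Qed.

HB.instance Definition _ :=
  GRing.Zmodule_isLmodule.Build {mpoly K[2]} (twist V theta)
    twist_scalerA twist_scale1r twist_scalerDr twist_scalerDl.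
End Twist.

(* A derivation of [weakly_isomorphic V W] is a finite chain V_1 = V, ...,
   V_k = W read from its first term; [weak_nil] is the case k = 1. *)
Inductive weakly_isomorphic :
    lmodType {mpoly K[2]} -> lmodType {mpoly K[2]} -> Prop :=
| weak_nil V : weakly_isomorphic V V
| weak_iso V U W :
    mod_isomorphic V U -> weakly_isomorphic U W -> weakly_isomorphic V W
| weak_twist V theta W :
    linear_automorphism theta ->
    weakly_isomorphic (twist V theta) W -> weakly_isomorphic V W.

(* K<P,Q> is the space of coordinate rows, so it is two-dimensional even when P
   and Q act as linearly dependent operators. *)
Definition assoc_lie V : Type := ('rV[K]_2 * kspace V)%type.
HB.instance Definition _ V := GRing.Lmodule.on (assoc_lie V).

Section AssocLie.
Variable V : lmodType {mpoly K[2]}.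
Implicit Types u v w : assoc_lie V.

(* The coordinate row a stands for a_0 P + a_1 Q, which acts on V as
   multiplication by a_0 x + a_1 y. *)
Definition assoc_act (a : 'rV[K]_2) (v : kspace V) : kspace V :=
  linform a *: (v : V).

Definition assoc_lieb u v : assoc_lie V :=
  (0, assoc_act u.1 v.2 - assoc_act v.1 u.2).

Lemma assoc_act_linear a : linear (assoc_act a).
Proof.
move=> c u v; have kE (w : kspace V) : c *: w = c%:MP *: (w : V) :> V by [].
by rewrite /assoc_act !kE [LHS]scalerDr !scalerA mulrC.
Qed.

Lemma assoc_act_linearl (v : kspace V) : linear (assoc_act^~ v).
Proof.
move=> c a b; have kE (w : kspace V) : c *: w = c%:MP *: (w : V) :> V by [].
by rewrite /assoc_act kE scalerA mul_mpolyC linearP [LHS]scalerDl.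
Qed.

Lemma assoc_actC a b (v : kspace V) :
  assoc_act a (assoc_act b v) = assoc_act b (assoc_act a v).
Proof. by rewrite /assoc_act !scalerA mulrC. Qed.

Fact assoc_lieb_linearr u : linear (assoc_lieb u).
Proof.
move=> c v w; rewrite /assoc_lieb /= assoc_act_linear assoc_act_linearl.
apply: injective_projections => /=; first by rewrite scaler0 addr0.
by rewrite scalerBr opprD addrACA.
Qed.

Fact assoc_lieb_linearl w : linear (assoc_lieb^~ w).
Proof.
move=> c u v; rewrite /assoc_lieb /= assoc_act_linear assoc_act_linearl.
apply: injective_projections => /=; first by rewrite scaler0 addr0.
by rewrite scalerBr opprD addrACA.
Qed.

Fact assoc_liebxx u : assoc_lieb u u = 0.
Proof. by rewrite /assoc_lieb subrr. Qed.

Fact assoc_lieb_jacobi u v w :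
  assoc_lieb u (assoc_lieb v w) + assoc_lieb v (assoc_lieb w u) +
  assoc_lieb w (assoc_lieb u v) = 0.
Proof.
have act0 (x : kspace V) : assoc_act 0 x = 0.
  by rewrite /assoc_act linear0 scale0r.
have actB a (x y : kspace V) :
    assoc_act a (x - y) = assoc_act a x - assoc_act a y.
  by rewrite /assoc_act scalerBr.
rewrite /assoc_lieb /= !act0 !actB !subr0.
apply: injective_projections => /=.
  by rewrite !addr0.
rewrite (assoc_actC v.1 u.1) (assoc_actC w.1 u.1) (assoc_actC w.1 v.1).
by rewrite [X in X + _]addrC subrKA addrC subrKA subrr.
Qed.

HB.instance Definition _ := Lmodule_isLie.Build K (assoc_lie V)
  assoc_lieb_linearl assoc_lieb_linearr assoc_liebxx assoc_lieb_jacobi.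

End AssocLie.
End Modules.

(* Main.v *)
Require Import Defs.
From HB Require Import structures.
From mathcomp Require Import all_boot all_order all_algebra.
From mathcomp Require Import zify.

(* A Lie isomorphism f : L_V -> L_W that maps V onto W yields at once an
   isomorphism of V with a twist of W. In general f(V) is an abelian ideal of
   codimension 2, and everything depends on the rank of the composite
   phi : V -> L_W -> L_W/W = K^2.
   - Rank 2: the submodule W meet f(V) has codimension at most 2 in W, is
     killed by x and y and contains xW + yW. The latter has dimension at most
     4 < n - 2, so W has a one-dimensional direct summand with trivial action,
     against indecomposability.
   - Rank 1: let a span the image of phi. The linear form a kills the
     hyperplane W meet f(V) of W, and V and W are both one-dimensional
     extensions of this hyperplane; since L_V/V lifts to an abelian subalgebra
     of L_V, the two extensions agree up to a linear change of the variables. *)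

Set Implicit Arguments.
Unset Strict Implicit.
Unset Printing Implicit Defensive.

Import GRing.Theory.
Local Open Scope ring_scope.

(** * Polynomial induction, and linear maps in coordinates *)

Lemma mpoly_alg_ind (n : nat) (R : nzRingType) (P : {mpoly R[n]} -> Prop) :
  (forall c, P c%:MP) -> (forall i, P 'X_i) ->
  (forall p q, P p -> P q -> P (p + q)) ->
  (forall p q, P p -> P q -> P (p * q)) -> forall p, P p.
Proof.
move=> PC PX PD PM; elim/mpolyind=> [|c m p _ _ Pp]; first by rewrite -mpolyC0.
apply: (PD) => //; rewrite -mul_mpolyC; apply: (PM) => //.
rewrite mpolyXE_id; elim/big_rec: _ => [|i q _ Pq]; first by rewrite -mpolyC1.
apply: (PM) => //; elim: (m i) => [|k IHk]; first by rewrite expr0 -mpolyC1.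
by rewrite exprS; apply: (PM).
Qed.

Definition pack_linear (K : fieldType) (U V : lmodType K) (g : U -> V)
  (gl : linear g) : {linear U -> V} :=
  HB.pack g (GRing.isLinear.Build K U V *:%R g gl).

Lemma linear_inj_bij (K : fieldType) (U V : lmodType K) (n : nat)
  (g : {linear U -> V}) :
  inhabited (Vector.axiom n U) -> inhabited (Vector.axiom n V) ->
  injective g -> bijective g.
Proof.
move=> [[s sl [s' sK s'K]]] [[t tl [t' tK t'K]]] g_inj.
pose S' := pack_linear (@GRing.can2_linear _ _ _ (pack_linear sl) _ sK s'K).
pose A := lin1_mx (pack_linear tl \o g \o S').
have AE u : s u *m A = t (g u) by rewrite mul_rV_lin1 /= sK.
have uA : A \in unitmx.
  rewrite -row_free_unit; apply: inj_row_free => v; rewrite -(s'K v) AE => tg0.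
  have [s0 t0] := (linear0 (pack_linear sl), linear0 (pack_linear tl)).
  rewrite -[RHS]s0 /=; congr (s _); apply: g_inj.
  by apply: (can_inj tK); rewrite tg0 linear0 -[LHS]t0.
exists (fun v => s' (t v *m invmx A)) => [u|v].
  by rewrite -AE mulmxK // sK.
by apply: (can_inj tK); rewrite -AE s'K mulmxKV.
Qed.

(** * Bases of the space of linear forms as 2 by 2 matrices *)

Section Rows.
Variable K : fieldType.
Implicit Types a b : 'rV[K]_2.

Definition rows2 a b : 'M[K]_2 := \matrix_i (if i == 0 then a else b).

Lemma rows2_unit a b : a != 0 -> ~~ (b <= a)%MS -> rows2 a b \in unitmx.
Proof.
move=> a0 ba; rewrite -row_free_unit; apply: inj_row_free => v.
rewrite mulmx_sum_row !big_ord_recl big_ord0 addr0 !rowK /= => vab.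
have v1 : v 0 (lift ord0 ord0) = 0.
  apply: contraNeq ba => v1; apply/sub_rVP.
  exists (- ((v 0 (lift ord0 ord0))^-1 * v 0 0)).
  apply: (scalerI v1); rewrite scalerA mulrN mulrA mulfV // mul1r scaleNr.
  by apply/eqP; rewrite -addr_eq0 addrC vab.
move: vab; rewrite v1 scale0r addr0 => /eqP.
rewrite scaler_eq0 (negPf a0) orbF => /eqP v0.
apply/rowP => i; rewrite mxE; case: i => [[|[|//]] lt_i].
  by rewrite -[RHS]v0; congr (v _ _); apply: val_inj.
by rewrite -[RHS]v1; congr (v _ _); apply: val_inj.
Qed.

Lemma exists_not_sub_row a : exists b, ~~ (b <= a)%MS.
Proof.
have : ~~ (1%:M <= a)%MS.
  by apply/negP => /mxrankS; rewrite mxrank1 leqNgt ltnS rank_leq_row.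
by case/row_subPn => i; exists (row i 1%:M).
Qed.

End Rows.

(** * Action of linear forms on a module *)

Section Action.
Variables (K : fieldType) (V : lmodType {mpoly K[2]}).
Implicit Types (a b : 'rV[K]_2) (u v : kspace V).

HB.instance Definition _ a :=
  GRing.isLinear.Build K (kspace V) (kspace V) *:%R (@assoc_act K V a)
    (assoc_act_linear a).

Lemma kscaleE (c : K) v : c *: v = c%:MP *: (v : V).
Proof. by []. Qed.

Lemma assoc_actP c a b v :
  assoc_act (c *: a + b) v = c *: assoc_act a v + assoc_act b v.
Proof. exact: assoc_act_linearl. Qed.

Lemma assoc_act0l v : assoc_act 0 v = 0.
Proof. by rewrite /assoc_act linear0 scale0r. Qed.

Lemma assoc_actZl c a v : assoc_act (c *: a) v = c *: assoc_act a v.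
Proof. by have := assoc_actP c a 0 v; rewrite assoc_act0l !addr0. Qed.

Lemma assoc_actNl a v : assoc_act (- a) v = - assoc_act a v.
Proof. by rewrite -scaleN1r assoc_actZl scaleN1r. Qed.

Lemma linform_delta i : linform (delta_mx 0 i : 'rV[K]_2) = 'X_i.
Proof.
rewrite /linform (bigD1 i) //= mxE !eqxx scale1r big1 ?addr0 // => j ji.
by rewrite mxE (negPf ji) andbF scale0r.
Qed.

Lemma linform_mul (x : 'rV[K]_2) (A : 'M[K]_2) :
  linform (x *m A) = \sum_i x 0 i *: linform (row i A).
Proof.
by rewrite mulmx_sum_row linear_sum; apply: eq_bigr => i _; rewrite linearZ.
Qed.

Lemma assoc_act_sum (x : 'rV[K]_2) (A : 'M[K]_2) v :
  assoc_act (x *m A) v = \sum_i x 0 i *: assoc_act (row i A) v.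
Proof.
rewrite /assoc_act linform_mul scaler_suml; apply: eq_bigr => i _.
by rewrite -mul_mpolyC -scalerA.
Qed.

Lemma submod_closed_gen (U : {pred V}) :
  0 \in U -> {in U &, forall u v, u + v \in U} ->
  (forall c : K, {in U, forall u, c%:MP *: u \in U}) ->
  (forall i, {in U, forall u, 'X_i *: u \in U}) -> GRing.submod_closed U.
Proof.
move=> U0 UD UC UX; split=> // p u v uU vU; apply: (UD) => //.
elim/mpoly_alg_ind: p u uU {v vU} => [c|i|p q IHp IHq|p q IHp IHq] u uU.
- exact: UC.
- exact: UX.
- by rewrite scalerDl UD ?IHp ?IHq.
- by rewrite -scalerA IHp ?IHq.
Qed.

End Action.

(** * Linear twists, and Lie isomorphisms from weak isomorphisms *)

Section Twists.
Variable K : fieldType.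
Implicit Types (V W : lmodType {mpoly K[2]}) (A B : 'M[K]_2).

Definition linear_subst A : {lrmorphism {mpoly K[2]} -> {mpoly K[2]}} :=
  comp_mpoly [tuple linform (row i A) | i < 2].

Lemma linear_substX A i : linear_subst A 'X_i = linform (row i A).
Proof. by rewrite /linear_subst /= comp_mpolyXU -tnth_nth tnth_mktuple. Qed.

Lemma linear_subst_linform A a : linear_subst A (linform a) = linform (a *m A).
Proof.
rewrite linform_mul {1}/linform linear_sum.
apply: eq_bigr => i _; rewrite linearZ /=.
by rewrite -[comp_mpoly _ _]/(linear_subst A 'X_i) linear_substX.
Qed.

Lemma linear_substK A B :
  A *m B = 1%:M -> cancel (linear_subst A) (linear_subst B).
Proof.
move=> AB; elim/mpoly_alg_ind=> [c|i|p q IHp IHq|p q IHp IHq].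
- by rewrite /linear_subst /= !comp_mpolyC.
- by rewrite linear_substX linear_subst_linform -row_mul AB row1 linform_delta.
- by rewrite !rmorphD /= IHp IHq.
- by rewrite !rmorphM /= IHp IHq.
Qed.

Lemma linear_automorphism_subst A :
  A \in unitmx -> linear_automorphism (linear_subst A).
Proof.
move=> uA; split; last by exists A => // i; apply: linear_substX.
by exists (linear_subst (invmx A));
  apply: linear_substK; rewrite ?mulmxV ?mulVmx.
Qed.

(** For [C := invmx B *m A], the map [g] turns the action of row [i] of [C] on [V] into that of
    ['X_i] on [W], so it is [K[x,y]]-linear on the twist of [V] by [C]. *)
Lemma weakly_isomorphic_twisted V W (g : {linear kspace V -> kspace W}) A B :
  A \in unitmx -> B \in unitmx -> bijective g ->
  (forall i v, g (assoc_act (row i A) v) = assoc_act (row i B) (g v)) ->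
  weakly_isomorphic V W.
Proof.
move=> uA uB g_bij gact; pose C := invmx B *m A.
have gX i v : g (assoc_act (row i C) v) = ('X_i : {mpoly K[2]}) *: (g v : W).
  rewrite row_mul assoc_act_sum linear_sum -linform_delta.
  rewrite -[RHS]/(assoc_act _ _) -row1 -(mulVmx uB) row_mul assoc_act_sum.
  by apply: eq_bigr => j _; rewrite linearZ gact.
have gl : linear (g : twist V (linear_subst C) -> W).
  move=> p u v; rewrite [LHS]linearD; congr (_ + _).
  elim/mpoly_alg_ind: p u => [c|i|p q IHp IHq|p q IHp IHq] u.
  - rewrite -[_ *: _]/(linear_subst C c%:MP *: (u : V)).
    by rewrite /linear_subst /= comp_mpolyC -kscaleE linearZ.
  - rewrite -[_ *: _]/(linear_subst C 'X_i *: (u : V)) linear_substX.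
    exact: gX.
  - by rewrite !scalerDl [LHS]linearD IHp IHq.
  - by rewrite -!scalerA IHp IHq.
apply: (@weak_twist _ _ (linear_subst C)).
  by apply: linear_automorphism_subst; rewrite unitmx_mul unitmx_inv uB.
pose h : {linear twist V (linear_subst C) -> W} :=
  HB.pack (g : twist V (linear_subst C) -> W)
  (GRing.isLinear.Build {mpoly K[2]} (twist V (linear_subst C)) W *:%R g gl).
by apply: weak_iso (weak_nil _); exists h.
Qed.

Lemma assoc_liebE V (u v : assoc_lie V) :
  lieb u v = (0, assoc_act u.1 v.2 - assoc_act v.1 u.2).
Proof. by []. Qed.

Lemma lie_isomorphic_trans (L M N : lieAlgType K) :
  lie_isomorphic L M -> lie_isomorphic M N -> lie_isomorphic L N.
Proof.
move=> [f [f_bij fB]] [g [g_bij gB]]; exists (g \o f); split.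
  exact: bij_comp.
by move=> u v; rewrite /= fB gB.
Qed.

Lemma lie_isomorphic_assoc V W (g : {linear kspace V -> kspace W}) A :
  A \in unitmx -> bijective g ->
  (forall a v, g (assoc_act a v) = assoc_act (a *m A) (g v)) ->
  lie_isomorphic (assoc_lie V) (assoc_lie W).
Proof.
move=> uA [g' gK g'K] gact.
pose h (u : assoc_lie V) : assoc_lie W := (u.1 *m A, g u.2).
have hl : linear h.
  move=> c u v; apply: injective_projections => /=; last exact: linearP.
  by rewrite mulmxDl scalemxAl.
exists (pack_linear hl); split=> [|u v] /=.
  exists (fun u => (u.1 *m invmx A, g' u.2)) => -[a v] /=.
    by rewrite /h /= gK mulmxK.
  by rewrite /h /= g'K mulmxKV.
by rewrite !assoc_liebE /h /= mul0mx linearB /= !gact.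
Qed.

Lemma weakly_lie_isomorphic V W :
  weakly_isomorphic V W -> lie_isomorphic (assoc_lie V) (assoc_lie W).
Proof.
elim=> {V W} [V|V U W [g g_bij] _|V theta W [_ [A uA thetaX]] _].
- exists (idfun : {linear assoc_lie V -> assoc_lie V}); split=> //.
  by exists id.
- apply: lie_isomorphic_trans.
  have gl : linear (g : kspace V -> kspace U).
    by move=> c u v; rewrite !kscaleE; apply: linearP.
  apply: (@lie_isomorphic_assoc _ _ (pack_linear gl) 1%:M) => // [|a v].
    exact: unitmx1.
  by rewrite mulmx1; apply: linearZ.
- apply: lie_isomorphic_trans.
  have idl : linear (id : kspace V -> kspace (twist V theta)).
    move=> c u v; rewrite [RHS]/(theta c%:MP *: (u : V) + (v : V)).
    by rewrite -[c%:MP]mulr1 mul_mpolyC linearZ rmorph1 /= -mul_mpolyC mulr1.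
  (* A form [a] acts on the twist as [a *m A] acts on [V], so the identity map matches [a] with
     [a *m invmx A]. *)
  apply: (@lie_isomorphic_assoc _ _ (pack_linear idl) (invmx A)) => [||a v].
  + by rewrite unitmx_inv.
  + by exists id.
  rewrite /= -[RHS]/(theta (linform (a *m invmx A)) *: (v : V)).
  rewrite /linform linear_sum; under eq_bigr do rewrite linearZ /= thetaX.
  by rewrite -linform_mul mulmxKV.
Qed.

End Twists.

(** * Splitting off a trivial one-dimensional summand *)

(** A vector killed by [x] and [y] but outside xW + yW spans a direct summand; the kernel of [psi]
    contains one. *)
Lemma indecomposable_square_zero (K : fieldType) (W : lmodType {mpoly K[2]})
    (n : nat) (psi : {linear kspace W -> 'rV[K]_2}) :
  has_kdim W n -> (7 <= n)%N ->
  (forall a w, psi w = 0 -> assoc_act a w = 0) ->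
  (forall a w, psi (assoc_act a w) = 0) -> ~ indecomposable W.
Proof.
move=> [[t tl [t' tK t'K]]] n7 act0 psi_act [_ indecW].
pose T := pack_linear tl.
pose T' := pack_linear (@GRing.can2_linear _ _ _ T _ tK t'K).
have tZ a w : t (a *: w) = a *: t w by rewrite -[t]/(T : _ -> _) linearZ.
pose Psi := lin1_mx (psi \o T').
pose X i := lin1_mx (T \o @assoc_act K W (delta_mx 0 i) \o T').
have PsiE w : t w *m Psi = psi w by rewrite mul_rV_lin1 /= tK.
have XE i w : t w *m X i = t (assoc_act (delta_mx 0 i) w).
  by rewrite mul_rV_lin1 /= tK.
have kerX i : (kermx Psi <= kermx (X i))%MS.
  apply/rV_subP => v /sub_kermxP; rewrite -(t'K v) PsiE => /act0 xw.
  by apply/sub_kermxP; rewrite XE xw; apply: (linear0 T).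
have rkX i : (\rank (X i) <= 2)%N.
  have := mxrankS (kerX i); rewrite !mxrank_ker => rk.
  have Psi2 := rank_leq_col Psi; have Xn := rank_leq_row (X i).
  by move: rk Psi2 Xn n7; lia.
pose D := (X ord0 + X ord_max)%MS.
(* The kernel has dimension at least n - 2 >= 5, while [D], which represents xW + yW, has rank at
   most 2 + 2. *)
have : ~~ (kermx Psi <= D)%MS.
  apply/negP => /mxrankS; rewrite mxrank_ker.
  have := mxrank_adds_leqif (X ord0) (X ord_max); move=> [rkD _].
  have Psi2 := rank_leq_col Psi.
  move: rkD (rkX ord0) (rkX ord_max) Psi2 n7; rewrite -/D; lia.
case/row_subPn=> k; set c' := row k _ => c'D.
have c'Psi : c' *m Psi = 0 by rewrite -row_mul mulmx_ker row0.
(* Right multiplication by [cokermx D] vanishes exactly on [D]; a coordinate nonzero at [c'], once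
   scaled, is a functional [lam] with [lam c = 1] that kills xW + yW. *)
have /rV0Pn [j cj] : c' *m cokermx D != 0 by rewrite -submxE.
pose mu : {linear kspace W -> 'rV_n} := mulmxr (cokermx D) \o T.
pose lam w := mu w 0 j / (c' *m cokermx D) 0 j.
pose c := t' c'.
have lamD u v : lam (u + v) = lam u + lam v.
  by rewrite /lam linearD mxE mulrDl.
have lamZ a (u : kspace W) : lam (a *: u) = a * lam u.
  by rewrite /lam linearZ mxE mulrA.
have lam0 : lam 0 = 0 by rewrite /lam linear0 mxE mul0r.
have lamX i (u : W) : lam ('X_i *: u) = 0.
  have -> : 'X_i *: u = assoc_act (delta_mx 0 i) u :> W.
    by rewrite /assoc_act linform_delta.
  rewrite /lam /mu /= -XE; have XD : (X i <= D)%MS.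
    have [->|->] : i = ord0 \/ i = ord_max.
      by case: i => [[|[|//]] lti]; [left | right]; apply: val_inj.
    - exact: addsmxSl.
    - exact: addsmxSr.
  rewrite -mulmxA; move: XD; rewrite submxE => /eqP->.
  by rewrite mulmx0 mxE mul0r.
have lamc : lam c = 1 by rewrite /lam /mu /= t'K mulfV.
have cX i : 'X_i *: (c : W) = 0.
  by rewrite -linform_delta; apply: act0; rewrite -PsiE t'K.
pose U1 : {pred W} := [pred w | (w : kspace W) == lam w *: c].
pose U2 : {pred W} := [pred w | lam w == 0].
have [||w|w /eqP wc /eqP w0|U10|U20] := indecW U1 U2.
- apply: submod_closed_gen => [|u v|a u|i u]; rewrite !inE.
  + by rewrite lam0 scale0r.
  + by move=> /eqP uc /eqP vc; rewrite lamD scalerDl -uc -vc.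
  + by rewrite -kscaleE lamZ -scalerA => /eqP <-.
  + move=> /eqP uc; rewrite lamX scale0r uc kscaleE.
    by rewrite scalerA mulrC -scalerA cX scaler0.
- apply: submod_closed_gen => [|u v|a u|i u]; rewrite !inE.
  + by rewrite lam0.
  + by move=> /eqP u0 /eqP v0; rewrite lamD u0 v0 addr0.
  + by rewrite -kscaleE lamZ => /eqP->; rewrite mulr0.
  + by rewrite lamX.
- exists (lam w *: c), ((w : kspace W) - lam w *: c).
  rewrite !inE lamZ lamc mulr1 eqxx -scaleNr lamD lamZ lamc mulr1 subrr eqxx.
  by split=> //; rewrite scaleNr [RHS]addrC subrK.
- by rewrite wc w0 scale0r.
- have := U10 c; rewrite !inE lamc scale1r eqxx => /esym/eqP c0.
  by have := oner_neq0 K; rewrite -lamc c0 lam0 eqxx.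
(* If the kernel of [lam] is zero, then [c] spans [W], against n >= 7. *)
- have Wc (w : kspace W) : w = lam w *: c.
    apply/eqP; rewrite -subr_eq0; have := U20 (w - lam w *: c).
    by rewrite !inE -scaleNr lamD lamZ lamc mulr1 subrr eqxx => /esym.
  have : (1%:M <= c')%MS.
    apply/row_subP => i; apply/sub_rVP.
    by exists (lam (t' (row i 1%:M))); rewrite -[c']t'K -tZ -Wc t'K.
  by move/mxrankS; rewrite mxrank1 => rk; have := rank_leq_row c'; lia.
Qed.

(** * Components of a Lie homomorphism on the ideal [V] *)

Section LieIsomorphism.
Variables (K : fieldType) (V W : lmodType {mpoly K[2]}).
Variable f : {linear assoc_lie V -> assoc_lie W}.
Hypothesis fB : forall u v, f (lieb u v) = lieb (f u) (f v).

Definition row_part (u : kspace V) : 'rV[K]_2 := (f (0, u)).1.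
Definition module_part (u : kspace V) : kspace W := (f (0, u)).2.

Fact incl_linear : linear (fun u : kspace V => (0, u) : assoc_lie V).
Proof.
move=> c u v; apply: injective_projections => //=.
by rewrite scaler0 addr0.
Qed.

Fact row_part_linear : linear row_part.
Proof. by move=> c u v; rewrite /row_part incl_linear linearP. Qed.
HB.instance Definition _ := GRing.isLinear.Build K (kspace V) 'rV[K]_2 *:%R
  row_part row_part_linear.

Fact module_part_linear : linear module_part.
Proof. by move=> c u v; rewrite /module_part incl_linear linearP. Qed.
HB.instance Definition _ := GRing.isLinear.Build K (kspace V) (kspace W) *:%R
  module_part module_part_linear.

Lemma fE u : f (0, u) = (row_part u, module_part u).
Proof. exact: surjective_pairing. Qed.

(** This is [f] applied to the bracket of [x] and [u]; the row is zero because brackets in L_W lie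
    in [W]. *)
Lemma f_act (x : assoc_lie V) u : f (0, assoc_act x.1 u) =
  (0, assoc_act (f x).1 (module_part u) - assoc_act (row_part u) (f x).2).
Proof.
by rewrite -[RHS](fB x (0, u)) assoc_liebE /= assoc_act0l subr0.
Qed.

Lemma row_part_act a u : row_part (assoc_act a u) = 0.
Proof. by rewrite /row_part (f_act (a, 0)). Qed.

Lemma module_part_act (x : assoc_lie V) u : module_part (assoc_act x.1 u) =
  assoc_act (f x).1 (module_part u) - assoc_act (row_part u) (f x).2.
Proof. by rewrite /module_part f_act. Qed.

(** [V] is abelian, so [f] sends [u] and [v] to commuting elements. *)
Lemma parts_comm u v :
  assoc_act (row_part u) (module_part v) =
  assoc_act (row_part v) (module_part u).
Proof.
apply/eqP; rewrite -subr_eq0 -(module_part_act (0, u)) assoc_act0l.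
by rewrite linear0.
Qed.

End LieIsomorphism.

(** The cases are the ranks 0, 1 and 2; in rank 1 any nonzero value spans the image. *)
Lemma linear_row2_cases (K : fieldType) (U : lmodType K) (n : nat)
    (g : {linear U -> 'rV[K]_2}) : inhabited (Vector.axiom n U) ->
  [\/ forall u, g u = 0,
      exists e, g e != 0 /\ forall u, (g u <= g e)%MS
    | forall a, exists u, g u = a].
Proof.
move=> [[t tl [t' tK t'K]]].
pose T' := pack_linear (@GRing.can2_linear _ _ _ (pack_linear tl) _ tK t'K).
pose A := lin1_mx (g \o T').
have AE v : v *m A = g (t' v) by rewrite mul_rV_lin1.
have gA u : (g u <= A)%MS by rewrite -[u]tK -AE submxMl.
have [/row_fullP [B BA]|A_nfull] := boolP (row_full A).
  by constructor 3 => a; exists (t' (a *m B)); rewrite -AE -mulmxA BA mulmx1.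
have [A0|/rowV0Pn [v /submxP [x ->] v0]] := eqVneq A 0.
  by constructor 1 => u; apply/eqP; have := gA u; rewrite A0 eqmx0 submx0.
constructor 2; exists (t' x); rewrite -AE; split=> // u.
apply: submx_trans (gA u) _; have [_ <-] := mxrank_leqif_sup (submxMl x A).
rewrite eqn_leq mxrankS ?submxMl //= rank_rV v0.
have := rank_leq_col A; move: A_nfull; rewrite /row_full; lia.
Qed.

(** * Weak isomorphism from a Lie isomorphism [f] with inverse [F] *)

Section LieEquivalence.
Variables (K : fieldType) (V W : lmodType {mpoly K[2]}) (n : nat).
Variables (f : {linear assoc_lie V -> assoc_lie W}).
Variables (F : {linear assoc_lie W -> assoc_lie V}).
Hypothesis fB : forall u v, f (lieb u v) = lieb (f u) (f v).
Hypotheses (fK : cancel f F) (FK : cancel F f).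
Hypotheses (dimV : has_kdim V n) (dimW : has_kdim W n).

(** [phi] and [s] are the components of [f] on [V], [psi] and [G] those of [F] on [W]. The kernel of
    [psi] is the intersection of [W] with f(V), and [s] maps the kernel of [phi] bijectively onto
    it, with inverse given by [G]. *)
Let phi : {linear kspace V -> 'rV[K]_2} := row_part f.
Let s : {linear kspace V -> kspace W} := module_part f.
Let G : {linear kspace W -> kspace V} := module_part F.
Let psi : {linear kspace W -> 'rV[K]_2} := row_part F.

Lemma F_lieb u v : F (lieb u v) = lieb (F u) (F v).
Proof. by rewrite -{1}[u]FK -{1}[v]FK -fB fK. Qed.

Lemma f_incl u : f (0, u) = (phi u, s u).
Proof. exact: fE. Qed.

Lemma F_incl w : F (0, w) = (psi w, G w).
Proof. exact: fE. Qed.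

Lemma phi0_inj u v : phi u = phi v -> s u = s v -> u = v.
Proof.
move=> phi_uv s_uv; have /(can_inj fK) : f (0, u) = f (0, v).
  by rewrite !f_incl phi_uv s_uv.
by case.
Qed.

Lemma phi_act a u : phi (assoc_act a u) = 0.
Proof. exact: (row_part_act fB a u). Qed.

Lemma eq_f_row_part0 x : (F x).1 = 0 -> x = f (0, (F x).2).
Proof. by move=> Fx; rewrite -Fx -surjective_pairing FK. Qed.

Lemma phi0_psi_s u : phi u = 0 -> psi (s u) = 0.
Proof. by move=> u0; rewrite /psi /= /row_part -u0 -f_incl fK. Qed.

Lemma row_part0_weakly_isomorphic :
  (forall u, phi u = 0) -> weakly_isomorphic V W.
Proof.
move=> phi0.
have s_bij : bijective s.
  apply: linear_inj_bij dimV dimW _ => u v; apply: phi0_inj.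
  by rewrite !phi0.
have gl : linear (fun a : 'rV[K]_2 => (f (a, 0)).1).
  move=> c a b.
  have -> : (c *: a + b, 0) = c *: (a, 0) + (b, 0) :> assoc_lie V.
    by apply: injective_projections => //=; rewrite scaler0 addr0.
  by rewrite linearP.
(* [N] is the map L_V/V -> L_W/W induced by [f], injective because f(V) = W. *)
pose N := lin1_mx (pack_linear gl).
have NE a : a *m N = (f (a, 0)).1 by rewrite mul_rV_lin1.
apply: (@weakly_isomorphic_twisted _ _ _ s 1%:M N) => [||//|i v].
- exact: unitmx1.
- rewrite -row_free_unit; apply: inj_row_free => a; rewrite NE => fa.
  have [s' _ s'K] := s_bij.
  have /(can_inj fK) [] // : f (a, 0) = f (0, s' (f (a, 0)).2).
  by rewrite f_incl s'K phi0 -fa -surjective_pairing.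
- rewrite [s _](module_part_act fB (row i 1%:M, 0)) -/(phi v) phi0 assoc_act0l.
  by rewrite subr0 -NE -row_mul mul1mx.
Qed.

(** If [psi] were zero, [F] would map [W] into [V], and onto it by dimension; then f(V) = W and
    [phi] would vanish. *)
Lemma exists_psi_neq0 : (exists u, phi u != 0) -> exists w, psi w != 0.
Proof.
move=> [e phi_e].
have [psi0|[w [psi_w _]]|psi_onto] := linear_row2_cases psi dimW.
- have [|g' g'K gK] := linear_inj_bij (g := G) dimW dimV.
    move=> u v Guv; have /(can_inj FK) [] // : F (0, u) = F (0, v).
    by rewrite !F_incl !psi0 -/(G u) Guv.
  have : F (0, g' e) = (0, e) by rewrite F_incl psi0 -/(G _) gK.
  move/(congr1 f); rewrite FK f_incl => /(congr1 fst) phi_e0.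
  by case/eqP: phi_e; apply: esym.
- by exists w.
- have [w wE] := psi_onto (delta_mx 0 0); exists w; rewrite wE.
  by apply/eqP => /matrixP/(_ 0 0)/eqP; rewrite !mxE oner_eq0.
Qed.

(** * Rank one: adapted bases of linear forms on both sides *)

Section RankOne.
Variables (e : kspace V) (b : 'rV[K]_2) (w1 : kspace W).
Hypotheses (phi_e : phi e != 0) (phi_sub : forall u, (phi u <= phi e)%MS).
Hypotheses (b_e : ~~ (b <= phi e)%MS) (psi_w1 : psi w1 != 0).

(** [q] and [r] are the classes modulo [V] of the preimages of [w1] and of [b]. *)
Let q := psi w1.
Let r := (F (b, 0)).1.

(** If [r] were [k *: q], then [b] minus [k *: w1] would lie in f(V), which puts [b] on the line of
    [phi e]. *)
Lemma rows2_q_r_unit : rows2 q r \in unitmx.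
Proof.
apply: rows2_unit => //; apply/negP => /sub_rVP[k rE].
have : (F ((b, 0) - k *: (0, w1))).1 = 0.
  by rewrite linearB linearZ F_incl /= -/r -/q rE subrr.
move/eq_f_row_part0; set v := (F _).2; rewrite f_incl => /(congr1 fst) /= bE.
by case/negP: b_e; rewrite -[b]subr0 -(scaler0 _ k) bE; apply: phi_sub.
Qed.

(** Here and in [s_r], apply [f] to the bracket of [u] with the preimage of [w1] or [b]: [w1] sees
    only the row part of f(u), and [b] only its module part. *)
Lemma s_q u : s (assoc_act q u) = - assoc_act (phi u) w1.
Proof.
rewrite [LHS](module_part_act fB (F (0, w1))) FK.
by rewrite assoc_act0l sub0r.
Qed.

Lemma s_r u : s (assoc_act r u) = assoc_act b (s u).
Proof. by rewrite [LHS](module_part_act fB (F (b, 0))) FK /= linear0 subr0. Qed.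

Lemma s_comm u v : assoc_act (phi u) (s v) = assoc_act (phi v) (s u).
Proof. exact: parts_comm. Qed.

(** The basis [q], [r] is matched with [- phi e], [b - d *: phi e]: the sign comes from [s_q], and
    [d] leaves room to move [b] along the line of [phi e]. *)
Lemma weakly_isomorphic_rows2 (g : {linear kspace V -> kspace W}) d :
  injective g -> (forall u, g (assoc_act q u) = assoc_act (- phi e) (g u)) ->
  (forall u, g (assoc_act r u) = assoc_act (b - d *: phi e) (g u)) ->
  weakly_isomorphic V W.
Proof.
move=> g_inj g_q g_r.
apply: (@weakly_isomorphic_twisted _ _ _ g (rows2 q r)
          (rows2 (- phi e) (b - d *: phi e))) => [|||i v].
- exact: rows2_q_r_unit.
- apply: rows2_unit; rewrite ?oppr_eq0 // eqmx_opp.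
  apply: contra b_e => /sub_rVP[k bE]; apply/sub_rVP; exists (k + d).
  by rewrite scalerDl -bE subrK.
- exact: linear_inj_bij dimV dimW g_inj.
- by rewrite !rowK; case: (i == 0).
Qed.

(** The coordinate of [phi u] on the line of [phi e]; the pseudo-inverse makes it visibly linear in
    [u]. *)
Definition phi_coord u := (phi u *m pinvmx (phi e)) 0 0.

Lemma phi_coordP c u v : phi_coord (c *: u + v) = c * phi_coord u + phi_coord v.
Proof. by rewrite /phi_coord linearP mulmxDl -scalemxAl !mxE. Qed.

Lemma phi_coordE u : phi u = phi_coord u *: phi e.
Proof.
by rewrite -mul_scalar_mx -mx11_scalar mulmxKpV.
Qed.

End RankOne.

(** Take [w1 := s e]; then [s] itself is the isomorphism. It is injective since [psi (s u)] is the
    coordinate of [phi u] times [psi (s e)]. *)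
Lemma rank_one_generic_weakly_isomorphic e :
  (forall u, (phi u <= phi e)%MS) -> psi (s e) != 0 -> weakly_isomorphic V W.
Proof.
move=> phi_sub psi_se; have [b b_e] := exists_not_sub_row (phi e).
have phi_e : phi e != 0 by apply: contraNneq psi_se => /phi0_psi_s->.
apply: (weakly_isomorphic_rows2 phi_e phi_sub b_e psi_se (g := s) (d := 0)).
- apply: raddf_inj => u su0; have phiE := phi_coordE phi_sub u.
  move: phiE; set c := phi_coord e u => phiE.
  have : psi (s (u - c *: e)) = 0.
    by apply: phi0_psi_s; rewrite linearB linearZ /= phiE subrr.
  rewrite linearB linearZ /= su0 sub0r linearN linearZ /= => /eqP.
  rewrite oppr_eq0 scaler_eq0 (negPf psi_se) orbF => /eqP c0.
  by apply: phi0_inj; rewrite ?linear0 // phiE c0 scale0r.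
- by move=> u; rewrite s_q s_comm assoc_actNl.
- by move=> u; rewrite s_r // scale0r subr0.
Qed.

(* Write V = ker phi + K e and W = s(ker phi) + K w'; the wanted isomorphism is
   s on ker phi and sends e to w'. *)
Lemma rank_one_split_weakly_isomorphic e :
  (forall u, (phi u <= phi e)%MS) -> phi e != 0 -> s e = 0 ->
  weakly_isomorphic V W.
Proof.
move=> phi_sub phi_e se0; have [b b_e] := exists_not_sub_row (phi e).
have [|w1 psi_w1] := exists_psi_neq0; first by exists e.
pose c := phi_coord e.
have phiE u : phi u = c u *: phi e by apply: phi_coordE.
have c0 u : phi u = 0 -> c u = 0.
  by move/eqP; rewrite phiE scaler_eq0 (negPf phi_e) orbF => /eqP.
have act_s u : assoc_act (phi e) (s u) = 0 by rewrite s_comm se0 linear0.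
pose u := (F (0, w1)).2; pose u' := (F (b, 0)).2; pose w' := w1 - s u.
have act_w' : assoc_act (phi e) w' = assoc_act (phi e) w1.
  by rewrite linearB /= act_s subr0.
(* Expanding the bracket of the preimages of [b] and [w1] gives b w1 = s(r u) - s(q u') = b s(u) +
   phi(u') w1. *)
have b_w' : assoc_act b w' = c u' *: assoc_act (phi e) w'.
  rewrite act_w' -assoc_actZl -phiE linearB /= -s_r.
  have := congr1 f (F_lieb (b, 0) (0, w1)).
  rewrite FK F_incl assoc_liebE /= assoc_act0l subr0 assoc_liebE.
  move/(congr1 snd).
  rewrite [X in _ = X -> _]/(s _) /= => ->.
  by rewrite linearB /= -/u -/u' s_q opprK addrAC subrr add0r.
(* As [s e = 0], the image of [s] is that of the kernel of [phi], inside the kernel of [psi]; so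
   [psi] separates it from [w']. *)
have psi_s x : psi (s x) = 0.
  have : psi (s (x - c x *: e)) = 0.
    by apply: phi0_psi_s; rewrite linearB linearZ /= phiE subrr.
  by rewrite linearB linearZ /= se0 scaler0 subr0.
have psi_w' : psi w' = psi w1 by rewrite /w' linearB /= psi_s subr0.
have gl : linear (fun x => s x + c x *: w').
  move=> k x y; rewrite linearP /= /c phi_coordP scalerDl (scalerDr k).
  rewrite scalerA -!addrA.
  by congr (_ + _); rewrite addrCA.
(* By [b_w'], the choice [d = c u'] makes [b - d *: phi e] kill [w']. *)
apply: (weakly_isomorphic_rows2 phi_e phi_sub b_e psi_w1
          (g := pack_linear gl) (d := c u')) => /=.
- apply: (raddf_inj (f := pack_linear gl)) => x /= gx0.
  have sx : s x = - (c x *: w').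
    by apply/eqP; rewrite -addr_eq0 gx0.
  have := psi_s x; rewrite sx linearN linearZ /= psi_w'.
  move/eqP; rewrite oppr_eq0 scaler_eq0 (negPf psi_w1) orbF => /eqP cx0.
  apply: phi0_inj; first by rewrite linear0 phiE cx0 scale0r.
  by rewrite linear0 sx cx0 scale0r oppr0.
- move=> x; rewrite s_q c0 ?scale0r ?addr0; last exact: phi_act.
  rewrite (phiE x) assoc_actNl linearD linearZ /= act_s add0r act_w'.
  by rewrite assoc_actZl.
- move=> x; rewrite s_r c0 ?scale0r ?addr0; last exact: phi_act.
  have -> : b - c u' *: row_part f e = - c u' *: phi e + b.
    by rewrite addrC scaleNr.
  rewrite assoc_actP ![assoc_act _ (_ + _ *: _)]linearD.
  rewrite /= !linearZ /= act_s add0r b_w'.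
  by rewrite [RHS]addrCA scaleNr !scalerA mulrC addNr addr0.
Qed.

Lemma rank_one_weakly_isomorphic e :
  phi e != 0 -> (forall u, (phi u <= phi e)%MS) -> weakly_isomorphic V W.
Proof.
move=> phi_e phi_sub; have [psi_se|] := eqVneq (psi (s e)) 0; last first.
  exact: rank_one_generic_weakly_isomorphic.
(* Now [s e] is in the kernel of [psi], hence comes from [G (s e)] in the kernel of [phi];
   subtracting this from [e] keeps [phi e] and makes [s e] vanish. *)
have fE' : f (0, G (s e)) = (0, s e).
  by rewrite -psi_se -F_incl FK psi_se.
have [phi_G s_G] : phi (G (s e)) = 0 /\ s (G (s e)) = s e.
  by move: fE'; rewrite f_incl => -[].
have phi_e' : phi (e - G (s e)) = phi e by rewrite linearB /= phi_G subr0.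
apply: (@rank_one_split_weakly_isomorphic (e - G (s e))); rewrite ?phi_e' //.
by rewrite linearB /= s_G subrr.
Qed.

(** If [psi w = 0], then [w] lies in f(V) and commutes with f(V); as [phi] is onto, every linear
    form kills [w]. *)
Lemma row_part_onto_decomposable :
  (7 <= n)%N -> (forall a, exists u, phi u = a) -> ~ indecomposable W.
Proof.
move=> n7 phi_onto.
apply: (indecomposable_square_zero (psi := psi) dimW n7) => a w.
  have [u <-] := phi_onto a => psi_w.
  have := module_part_act fB (F (0, w)) u; rewrite FK F_incl psi_w /=.
  by rewrite !assoc_act0l linear0 sub0r => /esym/eqP; rewrite oppr_eq0 => /eqP.
exact: (row_part_act F_lieb).
Qed.

End LieEquivalence.

(** * Both implications, the converse according to the rank of [phi] *)

Theorem theorem2 (K : closedFieldType) (charK0 : [pchar K] =i pred0)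
  (V W : lmodType {mpoly K[2]}) (n : nat)
  (indV : indecomposable V) (indW : indecomposable W)
  (dimV : has_kdim V n) (dimW : has_kdim W n) (n_ge7 : (7 <= n)%N) :
  weakly_isomorphic V W <-> lie_isomorphic (assoc_lie V) (assoc_lie W).
Proof.
split; first exact: weakly_lie_isomorphic.
case=> f [[F fK FK] fB].
pose F' := pack_linear (GRing.can2_linear fK FK).
pose phi : {linear kspace V -> 'rV[K]_2} := row_part f.
have [phi0|[e [phi_e phi_sub]]|phi_onto] := linear_row2_cases phi dimV.
- exact: (@row_part0_weakly_isomorphic _ _ _ n f F').
- exact: (@rank_one_weakly_isomorphic _ _ _ n f F' fB fK FK dimV dimW e).
- have decW := @row_part_onto_decomposable _ _ _ n f F' fB fK FK dimW n_ge7.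
  by case: (decW phi_onto).
Qed.
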